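(* Let $\sum_{n=0}^{\infty} a_n$ be a series of non-zero real numbers and suppose that $\rho_{\mathrm{ratio}}=\lim_{n\to\infty}\frac{|a_{n+1}|}{|a_n|}$ exists (finite or infinite). Then $\rho_{\mathrm{root}}=\lim_{n\to\infty}\sqrt[n]{|a_n|}$ exists (finite or infinite) and $\rho_{\mathrm{root}}=\rho_{\mathrm{ratio}}$. Moreover, $\rho_{\mathrm{root}}$ can be used for convergence verification in the same way as $\rho_{\mathrm{ratio}}$: if $\rho_{\mathrm{root}}<1$ the series $\sum a_n$ converges absolutely; if $\rho_{\mathrm{root}}>1$ or $\rho_{\mathrm{root}}$ is infinite the series diverges; and the case $\rho_{\mathrm{root}}=1$ is inconclusive, i.e. among series of non-zero real numbers for which $\rho_{\mathrm{ratio}}$ exists and $\rho_{\mathrm{root}}=1$ there are both absolutely convergent and divergent ones.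
   Context: Limits are understood in the extended sense: ''exists (finite or infinite)'' means that the sequence of nonnegative reals converges in $[0,\infty]$. The roots $\sqrt[n]{|a_n|}$ are taken for $n\ge 1$. *)

(* Defs.v *)
From Stdlib Require Import Reals.
From Coquelicot Require Import Coquelicot.
Open Scope R_scope.

(* [Rpower x y] is [exp (y * ln x)], so this is the n-th root for 0 < x and
   1 <= n.  It is only used with x = |a n| and a n <> 0; the meaningless value
   at n = 0 does not affect the limits below. *)
Definition nth_root (n : nat) (x : R) : R := Rpower x (/ INR n).

Definition nonzero_terms (a : nat -> R) : Prop := forall n : nat, a n <> 0.

Definition ratio_seq (a : nat -> R) (n : nat) : R := Rabs (a (S n)) / Rabs (a n).

Definition root_seq (a : nat -> R) (n : nat) : R := nth_root n (Rabs (a n)).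

(* [Lim_seq] is the limit only when [ex_lim_seq] holds, and [ex_lim_seq] allows
   any limit in [Rbar]; as both sequences are nonnegative, the limit, if it
   exists, lies in [0, +oo]. *)
Definition rho_ratio (a : nat -> R) : Rbar := Lim_seq (ratio_seq a).

Definition rho_root (a : nat -> R) : Rbar := Lim_seq (root_seq a).

Definition abs_convergent (a : nat -> R) : Prop := ex_series (fun n => Rabs (a n)).

Definition divergent (a : nat -> R) : Prop := ~ ex_series a.

(* Main.v *)
Require Import Defs.
From Stdlib Require Import Reals.
From Coquelicot Require Import Coquelicot.
From Stdlib Require Import Lra Lia.
Open Scope R_scope.

(** Taking logarithms turns the ratios into the increments of
    [u n = ln |a n|] and the roots into the averages [u n / n], because
    [|a (S n)| / |a n| = exp (u (S n) - u n)] and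
    [|a n| ^ (1/n) = exp (u n / n)].  If the increments tend to [l], finite or
    infinite, so do the averages ([is_lim_seq_increments_div_INR], a form of
    the Stolz-Cesaro theorem): a bound [c] on the increments from some rank on
    forces [u n <= c * n + constant], and the constant is negligible after
    division by [n].  Logarithm and exponential extend to mutually inverse
    bijections between [[0, +oo]] and [[-oo, +oo]], so the limit of the roots is
    recovered from that of the averages ([is_lim_seq_exp_reflect]).

    Once the two limits agree, absolute convergence below 1 is d'Alembert's
    test; above 1, roots eventually larger than 1 mean terms eventually larger
    than 1 in absolute value, which cannot tend to 0.  The terms
    [1 / ((n+1)(n+2))], whose sum telescopes, and the constant terms 1 show that
    the value 1 decides nothing. *)

(** * Averages of a sequence with convergent increments *)

Lemma eventually_INR_gt (M : R) : eventually (fun n => M < INR n).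
Proof.
  exact (proj2 (is_lim_seq_spec INR p_infty) is_lim_seq_INR M).
Qed.

Lemma increments_le_bound (u : nat -> R) (c : R) (N k : nat) :
  (forall n, (N <= n)%nat -> u (S n) - u n <= c) ->
  u (N + k)%nat <= u N + c * INR k.
Proof.
  intros H; induction k as [|k IH].
  - rewrite Nat.add_0_r; simpl; lra.
  - rewrite Nat.add_succ_r, S_INR.
    specialize (H (N + k)%nat ltac:(lia)); lra.
Qed.

(** From rank [N] on, [u n <= c * n + (u N - c * N)]; the slack [c' - c] absorbs
    the constant as soon as [n] exceeds [(u N - c * N) / (c' - c)]. *)
Lemma increments_le_div_INR_lt (u : nat -> R) (c c' : R) :
  c < c' ->
  eventually (fun n => u (S n) - u n <= c) ->
  eventually (fun n => u n / INR n < c').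
Proof.
  intros Hc [N HN].
  destruct (eventually_INR_gt (Rmax 0 ((u N - c * INR N) / (c' - c))))
    as [M HM].
  exists (N + M)%nat; intros n Hn.
  specialize (HM n ltac:(lia)); apply Rmax_Rlt in HM as [Hn0 HM].
  apply Rlt_div_l in HM; [|lra].
  apply Rlt_div_l; [exact Hn0|].
  pose proof (increments_le_bound u c N (n - N) HN) as Hb.
  replace (N + (n - N))%nat with n in Hb by lia.
  rewrite minus_INR in Hb by lia.
  nra.
Qed.

Lemma increments_ge_div_INR_gt (u : nat -> R) (c c' : R) :
  c' < c ->
  eventually (fun n => c <= u (S n) - u n) ->
  eventually (fun n => c' < u n / INR n).
Proof.
  intros Hc H.
  assert (H' : eventually (fun n => - u (S n) - - u n <= - c)).
  { revert H; apply filter_imp; intros n Hn; lra. }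
  apply (increments_le_div_INR_lt (fun n => - u n) (- c) (- c')) in H';
    [|lra].
  revert H'; apply filter_imp; intros n Hn.
  unfold Rdiv in *; lra.
Qed.

Lemma is_lim_seq_increments_div_INR (u : nat -> R) (l : Rbar) :
  is_lim_seq (fun n => u (S n) - u n) l ->
  is_lim_seq (fun n => u n / INR n) l.
Proof.
  intros H; apply is_lim_seq_spec in H; apply is_lim_seq_spec.
  destruct l as [l| |]; simpl in *.
  - intros eps.
    specialize (H (pos_div_2 eps)); simpl in H.
    pose proof (cond_pos eps) as He.
    assert (Hup : eventually (fun n => u n / INR n < l + eps)).
    { apply (increments_le_div_INR_lt u (l + eps / 2)); [lra|].
      revert H; apply filter_imp; intros n Hn.
      apply Rabs_def2 in Hn; lra. }
    assert (Hlo : eventually (fun n => l - eps < u n / INR n)).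
    { apply (increments_ge_div_INR_gt u (l - eps / 2)); [lra|].
      revert H; apply filter_imp; intros n Hn.
      apply Rabs_def2 in Hn; lra. }
    generalize (filter_and _ _ Hup Hlo); apply filter_imp; intros n [H1 H2].
    apply Rabs_def1; lra.
  - intros M; apply (increments_ge_div_INR_gt u (M + 1)); [lra|].
    generalize (H (M + 1)); apply filter_imp; intros n Hn; lra.
  - intros M; apply (increments_le_div_INR_lt u (M - 1)); [lra|].
    generalize (H (M - 1)); apply filter_imp; intros n Hn; lra.
Qed.

(** * From ratios to roots through the logarithm *)

(** The exponential is a homeomorphism from [[-oo, +oo]] onto [[0, +oo]]: a
    limit [L] of [exp (v n)] is the exponential of a limit [l] of [v n], with
    [l = -oo] for [L = 0], and any other sequence tending to [l] has
    exponentials tending to the same [L]. *)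
Lemma is_lim_seq_exp_reflect (v : nat -> R) (L : Rbar) :
  is_lim_seq (fun n => exp (v n)) L ->
  exists l : Rbar, is_lim_seq v l /\
    forall w, is_lim_seq w l -> is_lim_seq (fun n => exp (w n)) L.
Proof.
  intros H.
  assert (HL : Rbar_le 0 L).
  { apply (is_lim_seq_le (fun _ => 0) (fun n => exp (v n))); trivial.
    - intros n; apply Rlt_le, exp_pos.
    - apply is_lim_seq_const. }
  assert (Hln : forall l, is_lim_seq (fun n => ln (exp (v n))) l ->
                          is_lim_seq v l).
  { intros l; apply is_lim_seq_ext; intros n; apply ln_exp. }
  destruct L as [L| |]; simpl in HL; [|  |contradiction].
  - destruct HL as [HL|HL].
    + exists (ln L); split.
      * apply Hln, is_lim_seq_continuous; trivial.
        apply derivable_continuous_pt; exists (/ L).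
        apply derivable_pt_lim_ln, HL.
      * intros w Hw.
        rewrite <- (exp_ln L HL).
        apply is_lim_seq_continuous; trivial.
        apply derivable_continuous_pt, derivable_pt_exp.
    + subst L; exists m_infty; split.
      * apply Hln.
        unfold is_lim_seq.
        (* [ln] has limit [-oo] only along positive arguments. *)
        apply (filterlim_comp _ _ _ (fun n => exp (v n)) ln _ (at_right 0));
          [|exact is_lim_ln_0].
        intros P HP; specialize (H _ HP).
        unfold filtermap in *; revert H.
        apply filter_imp; intros n Hn; apply Hn, exp_pos.
      * intros w Hw.
        apply (is_lim_comp_seq exp w m_infty); trivial.
        -- exact is_lim_exp_m.
        -- exists 0%nat; discriminate.
  - exists p_infty; split.
    + apply Hln, (is_lim_comp_seq ln (fun n => exp (v n)) p_infty); trivial.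
      * exact is_lim_ln_p.
      * exists 0%nat; discriminate.
    + intros w Hw.
      apply (is_lim_comp_seq exp w p_infty); trivial.
      * exact is_lim_exp_p.
      * exists 0%nat; discriminate.
Qed.

Lemma ratio_seq_exp (a : nat -> R) (n : nat) :
  nonzero_terms a ->
  ratio_seq a n = exp (ln (Rabs (a (S n))) - ln (Rabs (a n))).
Proof.
  intros Ha; unfold ratio_seq, Rminus.
  rewrite exp_plus, exp_Ropp, !exp_ln; trivial; apply Rabs_pos_lt, Ha.
Qed.

Lemma root_seq_exp (a : nat -> R) (n : nat) :
  root_seq a n = exp (ln (Rabs (a n)) / INR n).
Proof.
  unfold root_seq, nth_root, Rpower, Rdiv; now rewrite Rmult_comm.
Qed.

Lemma is_lim_seq_root_of_ratio (a : nat -> R) (L : Rbar) :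
  nonzero_terms a ->
  is_lim_seq (ratio_seq a) L -> is_lim_seq (root_seq a) L.
Proof.
  intros Ha H.
  apply (is_lim_seq_ext _ (fun n => exp (ln (Rabs (a (S n))) - ln (Rabs (a n)))))
    in H; [|now intros n; apply ratio_seq_exp].
  apply is_lim_seq_exp_reflect in H as (l & Hl & Hexp).
  apply (is_lim_seq_increments_div_INR (fun n => ln (Rabs (a n)))) in Hl.
  apply Hexp in Hl; revert Hl.
  apply is_lim_seq_ext; intros n; symmetry; apply root_seq_exp.
Qed.

(** * Convergence and divergence *)

Lemma is_lim_seq_eventually_gt (u : nat -> R) (c : R) (l : Rbar) :
  Rbar_lt c l -> is_lim_seq u l -> eventually (fun n => c < u n).
Proof.
  intros Hc Hu.
  exact (Hu _ (open_Rbar_gt' l c Hc)).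
Qed.

Lemma abs_convergent_of_ratio_lt_1 (a : nat -> R) (L : Rbar) :
  nonzero_terms a -> is_lim_seq (ratio_seq a) L -> Rbar_lt L 1 ->
  abs_convergent a.
Proof.
  intros Ha H HL.
  assert (H0 : Rbar_le 0 L).
  { apply (is_lim_seq_le (fun _ => 0) (ratio_seq a)); trivial.
    - intros n; rewrite ratio_seq_exp by trivial; apply Rlt_le, exp_pos.
    - apply is_lim_seq_const. }
  destruct L as [L| |]; simpl in *; [|contradiction|contradiction].
  apply (ex_series_DAlembert a L HL Ha).
  revert H; apply is_lim_seq_ext; intros n.
  unfold ratio_seq; symmetry; apply Rabs_div, Ha.
Qed.

Lemma Rabs_gt_1_of_root_gt_1 (a : nat -> R) (n : nat) :
  nonzero_terms a -> (0 < n)%nat -> 1 < root_seq a n -> 1 < Rabs (a n).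
Proof.
  intros Ha Hn H.
  rewrite root_seq_exp, <- exp_0 in H; apply exp_lt_inv in H.
  apply lt_INR in Hn; simpl in Hn.
  apply Rlt_div_r in H; trivial; rewrite Rmult_0_l, <- ln_1 in H.
  apply ln_lt_inv; trivial; [lra|apply Rabs_pos_lt, Ha].
Qed.

Lemma divergent_of_root_gt_1 (a : nat -> R) (L : Rbar) :
  nonzero_terms a -> is_lim_seq (root_seq a) L -> Rbar_lt 1 L -> divergent a.
Proof.
  intros Ha H HL Hs.
  apply ex_series_lim_0, is_lim_seq_spec in Hs.
  destruct (Hs (mkposreal 1 Rlt_0_1)) as [N HN]; simpl in HN.
  destruct (is_lim_seq_eventually_gt _ _ _ HL H) as [M HM].
  specialize (HN (S (N + M)) ltac:(lia)).
  specialize (HM (S (N + M)) ltac:(lia)).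
  apply Rabs_gt_1_of_root_gt_1 in HM; trivial; [|lia].
  rewrite Rminus_0_r in HN; lra.
Qed.

(** * A convergent series whose ratios tend to 1 *)

Definition pronic_inv (n : nat) : R := / ((INR n + 1) * (INR n + 2)).

Lemma pronic_inv_pos (n : nat) : 0 < pronic_inv n.
Proof.
  pose proof (pos_INR n); apply Rinv_0_lt_compat; nra.
Qed.

Lemma is_lim_seq_inv_INR_plus (c : R) : is_lim_seq (fun n => / (INR n + c)) 0.
Proof.
  apply (is_lim_seq_inv _ p_infty); [|discriminate].
  apply (is_lim_seq_plus _ _ p_infty c).
  - exact is_lim_seq_INR.
  - apply is_lim_seq_const.
  - reflexivity.
Qed.

(** The sum telescopes, as [1 / ((k+1)(k+2)) = 1 / (k+1) - 1 / (k+2)]. *)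
Lemma sum_pronic_inv (n : nat) : sum_n pronic_inv n = 1 - / (INR n + 2).
Proof.
  unfold pronic_inv; induction n as [|n IH].
  - rewrite sum_O; simpl; field.
  - rewrite sum_Sn, IH, S_INR; unfold plus; simpl.
    pose proof (pos_INR n); field; lra.
Qed.

Lemma ex_series_pronic_inv : ex_series pronic_inv.
Proof.
  exists 1; change (is_lim_seq (sum_n pronic_inv) 1).
  apply (is_lim_seq_ext (fun n => 1 - / (INR n + 2)));
    [intros n; symmetry; apply sum_pronic_inv|].
  replace (Finite 1) with (Finite (1 - 0)) by (f_equal; ring).
  apply is_lim_seq_minus'; [apply is_lim_seq_const|].
  apply is_lim_seq_inv_INR_plus.
Qed.

Lemma is_lim_seq_ratio_pronic_inv : is_lim_seq (ratio_seq pronic_inv) 1.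
Proof.
  apply (is_lim_seq_ext (fun n => 1 - 2 * / (INR n + 3))).
  - intros n; unfold ratio_seq.
    rewrite !Rabs_pos_eq by apply Rlt_le, pronic_inv_pos.
    unfold pronic_inv; rewrite S_INR.
    pose proof (pos_INR n); field; lra.
  - replace (Finite 1) with (Finite (1 - 2 * 0)) by (f_equal; ring).
    apply is_lim_seq_minus'; [apply is_lim_seq_const|].
    apply is_lim_seq_mult'; [apply is_lim_seq_const|].
    apply is_lim_seq_inv_INR_plus.
Qed.

(** * The ratio and root tests *)

Theorem theorem2p3 :
  (forall a : nat -> R,
     nonzero_terms a ->
     ex_lim_seq (ratio_seq a) ->
     ex_lim_seq (root_seq a) /\
     rho_root a = rho_ratio a /\
     (Rbar_lt (rho_root a) (Finite 1) -> abs_convergent a) /\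
     (Rbar_lt (Finite 1) (rho_root a) \/ rho_root a = p_infty -> divergent a)) /\
  (exists a : nat -> R,
     nonzero_terms a /\ ex_lim_seq (ratio_seq a) /\
     ex_lim_seq (root_seq a) /\ rho_root a = Finite 1 /\ abs_convergent a) /\
  (exists a : nat -> R,
     nonzero_terms a /\ ex_lim_seq (ratio_seq a) /\
     ex_lim_seq (root_seq a) /\ rho_root a = Finite 1 /\ divergent a).
Proof.
  split; [|split].
  - intros a Ha [L HL].
    pose proof (is_lim_seq_root_of_ratio a L Ha HL) as Hroot.
    unfold rho_root, rho_ratio.
    rewrite (is_lim_seq_unique _ _ HL), (is_lim_seq_unique _ _ Hroot).
    split; [now exists L|split; [reflexivity|split]].
    + now apply abs_convergent_of_ratio_lt_1.
    + intros H; apply (divergent_of_root_gt_1 a L); trivial.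
      destruct H as [H|H]; [exact H|now rewrite H].
  - exists pronic_inv.
    assert (Ha : nonzero_terms pronic_inv)
      by (intros n; apply Rgt_not_eq, pronic_inv_pos).
    pose proof is_lim_seq_ratio_pronic_inv as HL.
    pose proof (is_lim_seq_root_of_ratio _ _ Ha HL) as Hroot.
    repeat split; trivial.
    + now exists 1.
    + now exists 1.
    + exact (is_lim_seq_unique _ _ Hroot).
    + unfold abs_convergent; apply (ex_series_ext pronic_inv).
      * intros n; symmetry; apply Rabs_pos_eq, Rlt_le, pronic_inv_pos.
      * exact ex_series_pronic_inv.
  - exists (fun _ => 1).
    assert (Ha : nonzero_terms (fun _ => 1)) by (intros n; exact R1_neq_R0).
    assert (HL : is_lim_seq (ratio_seq (fun _ => 1)) 1).
    { apply (is_lim_seq_ext (fun _ => 1)); [|apply is_lim_seq_const].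
      intros n; unfold ratio_seq; rewrite Rabs_R1; field. }
    pose proof (is_lim_seq_root_of_ratio _ _ Ha HL) as Hroot.
    repeat split; trivial.
    + now exists 1.
    + now exists 1.
    + exact (is_lim_seq_unique _ _ Hroot).
    + intros Hs; apply ex_series_lim_0, is_lim_seq_unique in Hs.
      rewrite Lim_seq_const in Hs; injection Hs; exact R1_neq_R0.
Qed.
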